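(* Let $q$ be a prime power and let $n\ge 3$ be an integer. Then the sizes of the balls of flag-rank radius $0,1,2,3$ in $\mathrm{U}(n,\mathbb{F}_q)$ are \[ b_q(n,0)=1,\qquad b_q(n,1)=1+n(q-1), \] \[ b_q(n,2)=1+n(q-1)+(n-1)q^2(q-1)+\binom{n}{2}(q-1)^2, \] and \[ \begin{aligned} b_q(n,3)={}&1+n(q-1)+(n-1)q^2(q-1)+\binom{n}{2}(q-1)^2\\ &+(n-2)q^4(q-1)+(n-1)(n-2)q^2(q-1)^2+\binom{n}{3}(q-1)^3. \end{aligned} \]
   Context: $\mathbb{F}_q$ is the finite field with $q$ elements. $\mathrm{U}(n,\mathbb{F}_q)$ is the $\mathbb{F}_q$-vector space of $n\times n$ upper triangular matrices over $\mathbb{F}_q$ (entries $m_{i,j}=0$ whenever $i>j$). For $M\in \mathrm{U}(n,\mathbb{F}_q)$ and $1\le i\le n$, $M_{[i]}$ is the $i\times(n-i+1)$ submatrix of $M$ obtained by deleting the first $i-1$ columns and the last $n-i$ rows (i.e. rows $1,\dots,i$ and columns $i,\dots,n$). The flag-rank weight of $M$ is $\mathrm{fr}(M)=\sum_{i=1}^{n}\mathrm{rk}(M_{[i]})$, and the flag-rank distance is $\mathrm{d}_{\mathrm{fr}}(A,B)=\mathrm{fr}(A-B)$. The number $b_q(n,t)$ is the size of a flag-rank ball of radius $t$ (independent of the center): $b_q(n,t)=|\{A\in \mathrm{U}(n,\mathbb{F}_q):\mathrm{fr}(A)\le t\}|$. *)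

(* Defs.v *)
From mathcomp Require Import all_boot all_order all_algebra.

Set Implicit Arguments.
Unset Strict Implicit.
Unset Printing Implicit Defensive.

Import GRing.Theory.

(* Indices are 0-based throughout: i : 'I_n stands for the integer i.+1 in
   {1, ..., n}. *)

(* MathComp's is_trig_mx is lower triangularity, hence the explicit form. *)
Definition upper_mx (F : finFieldType) (n : nat) : {set 'M[F]_n} :=
  [set M : 'M[F]_n |
    [forall i : 'I_n, forall j : 'I_n, (j < i) ==> (M i j == 0%R)]].

(* Rows 0, ..., i and columns i, ..., n.-1 of M: with k = i.+1 this is the
   k x (n - k + 1) submatrix M_[k]. *)
Definition flag_block (F : finFieldType) (n : nat) (M : 'M[F]_n) (i : 'I_n) :
    'M[F]_(i.+1, n - i) :=
  mxsub (widen_ord (ltn_ord i))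
        (fun j : 'I_(n - i) => cast_ord (subnKC (ltnW (ltn_ord i))) (rshift i j))
        M.

Definition flag_rank (F : finFieldType) (n : nat) (M : 'M[F]_n) : nat :=
  \sum_(i < n) \rank (flag_block M i).

(* Size of the flag-rank ball of radius t centred at 0. The flag-rank distance
   flag_rank (A - B) is translation invariant, so the centre is immaterial. *)
Definition ball_size (F : finFieldType) (n t : nat) : nat :=
  #|[set A in upper_mx F n | flag_rank A <= t]|.

(* Main.v *)
(* A block M_[i] of rank at least 2 forces total weight at least 4, so in the
   balls of radius at most 3 all blocks have rank at most 1 and the weight of M
   is the number of indices covered by the intervals [a, b] with M a b != 0.
   Such a matrix of weight w <= 3 is of exactly one of three kinds:
   - diagonal with w nonzero entries;
   - nonzero at one superdiagonal position (a, a+1), free at (a, a) and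
     (a+1, a+1), with w - 2 further nonzero diagonal entries;
   - (w = 3 only) the upper triangular part of a rank-one matrix supported on
     [a, a+2]^2 with nonzero entry at (a, a+2).
   Each kind is counted through an injective parametrisation. *)
Require Import Defs.
From mathcomp Require Import all_boot all_order all_algebra.
From mathcomp Require Import zify ring.

Set Implicit Arguments.
Unset Strict Implicit.
Unset Printing Implicit Defensive.

Import GRing.Theory.
Local Open Scope ring_scope.

(** * Rank at most one through minors *)

(** A factorisation through rank 0 or 1 makes each entry an empty sum or a single product, so the
    minors vanish. Conversely, a nonzero pivot [B a b] exhibits [B] as its rescaled column [b] times
    its row [a]. *)
Lemma mxrank_le1P (F : fieldType) (m n : nat) (B : 'M[F]_(m, n)) :
  reflect (forall a c b d, B a b * B c d = B a d * B c b) (\rank B <= 1)%N.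
Proof.
apply: (iffP idP) => [|minB].
  move: (mulmx_base B); move: (col_base B) (row_base B).
  case: (\rank B) => [|[|//]] C D <- _ a c b d; rewrite !mxE ?big_ord0 ?mul0r //.
  by rewrite !big_ord1; ring.
have [->|B0] := eqVneq B 0; first by rewrite mxrank0.
have [a [b Bab]] : exists a b, B a b != 0.
  have [/existsP[a /existsP[b ?]]|] := boolP [exists a, exists b, B a b != 0].
    by exists a, b.
  rewrite negb_exists => /forallP Z; case/eqP: B0; apply/matrixP => a b.
  have := Z a; rewrite negb_exists => /forallP/(_ b).
  by rewrite negbK mxE => /eqP.
suff -> : B = (\col_i (B i b / B a b)) *m row a B.
  by rewrite (leq_trans (mulmx_max_rank _ _)).
apply/matrixP => i j; rewrite !mxE big_ord1 !mxE.
by apply: (mulIf Bab); rewrite mulrC (minB a i b j); field.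
Qed.

(** * Covered indices and blocks of rank at most one *)

Section Spans.

Variables (F : finFieldType) (n : nat).
Implicit Types (M : 'M[F]_n) (i : 'I_n).

Definition flag_span M : {set 'I_n} :=
  [set i : 'I_n | [exists a : 'I_n, exists b : 'I_n,
                     (a <= i <= b)%N && (M a b != 0)]].

(** Every block has rank at most 1, phrased by minors so that only indices of [M] occur, not the
    dependent sizes of the blocks. *)
Definition small_blocks M :=
  forall (i a c b d : 'I_n), (a <= i <= b)%N -> (c <= i <= d)%N ->
    M a b * M c d = M a d * M c b.

Lemma flag_spanP M i :
  reflect (exists a b : 'I_n, [/\ (a <= i)%N, (i <= b)%N & M a b != 0])
          (i \in flag_span M).
Proof.
rewrite inE; apply: (iffP existsP) => [[a /existsP[b /andP[/andP[? ?] ?]]]|].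
  by exists a, b.
by move=> [a [b [ai ib ?]]]; exists a; apply/existsP; exists b; rewrite ai ib.
Qed.

Lemma flag_block_row i (a : 'I_n) :
  (a <= i)%N -> exists a' : 'I_i.+1, widen_ord (ltn_ord i) a' = a.
Proof. by move=> ai; exists (Ordinal (ai : (a < i.+1)%N)); apply: val_inj. Qed.

Lemma flag_block_col i (b : 'I_n) : (i <= b)%N ->
  exists b' : 'I_(n - i),
    cast_ord (subnKC (ltnW (ltn_ord i))) (rshift i b') = b.
Proof.
move=> ib; have lt_b : (b - i < n - i)%N by have := ltn_ord b; lia.
by exists (Ordinal lt_b); apply: val_inj; rewrite /= subnKC.
Qed.

Lemma rank_flag_block_gt0 M i : (0 < \rank (flag_block M i))%N = (i \in flag_span M).
Proof.
rewrite lt0n mxrank_eq0; apply/idP/flag_spanP => [B0|[a [b [ai ib Mab]]]].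
  have [/existsP[a /existsP[b Bab]]|] :=
    boolP [exists a, exists b, flag_block M i a b != 0].
    rewrite mxE in Bab; eexists; eexists; split; last exact: Bab.
      by have := ltn_ord a; rewrite /= ltnS.
    by rewrite /= leq_addr.
  rewrite negb_exists => /forallP Z; case/eqP: B0; apply/matrixP => a b.
  have := Z a; rewrite negb_exists => /forallP/(_ b).
  by rewrite negbK => /eqP->; rewrite mxE.
have [a' Ea] := flag_block_row ai; have [b' Eb] := flag_block_col ib.
apply: contraNneq Mab => /matrixP/(_ a' b'); rewrite !mxE Ea Eb => ->.
by rewrite eqxx.
Qed.

Lemma rank_flag_block_le1P M i :
  reflect (forall a c b d : 'I_n, (a <= i <= b)%N -> (c <= i <= d)%N ->
             M a b * M c d = M a d * M c b)
          (\rank (flag_block M i) <= 1)%N.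
Proof.
apply: (iffP (mxrank_le1P _)) => minM a c b d.
  move=> /andP[ai ib] /andP[ci id].
  have [a' Ea] := flag_block_row ai; have [b' Eb] := flag_block_col ib.
  have [c' Ec] := flag_block_row ci; have [d' Ed] := flag_block_col id.
  by have := minM a' c' b' d'; rewrite !mxE Ea Eb Ec Ed.
have := (ltn_ord a, ltn_ord c) => -[? ?].
by rewrite !mxE minM //= leq_addr andbT -ltnS.
Qed.

(** Each block contributes 0 or 1, and 1 exactly when its index is covered. *)
Lemma flag_rank_small_blocks M : small_blocks M -> flag_rank M = #|flag_span M|.
Proof.
move=> sM; rewrite /flag_rank -sum1_card [RHS]big_mkcond /=.
apply: eq_bigr => i _; rewrite -rank_flag_block_gt0.
have : (\rank (flag_block M i) <= 1)%N.
  by apply/rank_flag_block_le1P => *; apply: sM; eassumption.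
by case: (\rank _) => [|[]].
Qed.

(* A block of rank at least 2 has a nonzero entry outside its first column and
   one outside its last row, so both neighbouring blocks are nonzero too and
   the total weight is at least 4. *)
Lemma flag_rank_le3_small_blocks M : (flag_rank M <= 3)%N -> small_blocks M.
Proof.
move=> le3 i; apply/rank_flag_block_le1P; rewrite leqNgt; apply/negP => gt1.
have [/existsP[a /existsP[b /and3P[ai ib Mab]]]|right0] :=
  boolP [exists a : 'I_n, exists b : 'I_n,
           [&& (a <= i)%N, (i < b)%N & M a b != 0]]; last first.
  (* With nothing nonzero beyond its first column [i], the block has only vanishing minors, against
     [gt1]. The case of the last row is symmetric. *)
  move: gt1; rewrite ltnNge => /negP; apply; apply/rank_flag_block_le1P.
  have Z (a b : 'I_n) : (a <= i)%N -> (i <= b)%N -> b != i -> M a b = 0.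
    move=> ai ib nbi; apply: contraNeq right0 => Mab.
    apply/existsP; exists a; apply/existsP; exists b.
    by rewrite ai Mab ltn_neqAle ib eq_sym nbi.
  move=> a c b d /andP[ai ib] /andP[ci id].
  have [->|nbi] := eqVneq b i.
    have [->//|ndi] := eqVneq d i.
    by rewrite (Z _ _ _ _ ndi) // (Z a _ _ _ ndi) // mulr0 mul0r.
  by rewrite (Z _ _ _ _ nbi) // (Z c _ _ _ nbi) // mulr0 mul0r.
have [/existsP[c /existsP[d /and3P[ci id Mcd]]]|left0] :=
  boolP [exists a : 'I_n, exists b : 'I_n,
           [&& (a < i)%N, (i <= b)%N & M a b != 0]]; last first.
  move: gt1 {a b ai ib Mab}; rewrite ltnNge => /negP; apply.
  apply/rank_flag_block_le1P.
  have Z (a b : 'I_n) : (a <= i)%N -> (i <= b)%N -> a != i -> M a b = 0.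
    move=> ai ib nai; apply: contraNeq left0 => Mab.
    apply/existsP; exists a; apply/existsP; exists b.
    by rewrite ib Mab ltn_neqAle ai nai.
  move=> a c b d /andP[ai ib] /andP[ci id].
  have [->|nai] := eqVneq a i.
    have [->|nci] := eqVneq c i; first by rewrite mulrC.
    by rewrite (Z _ _ _ _ nci) // (Z _ b _ _ nci) // !mulr0.
  by rewrite (Z _ _ _ _ nai) // (Z _ d _ _ nai) // !mul0r.
have lt_h : (i.+1 < n)%N by have := ltn_ord b; lia.
(* [i.-1] is a genuine predecessor: [c < i] rules out [i = 0], which is what makes [g] differ from
   [i]. *)
have lt_g : (i.-1 < n)%N by have := ltn_ord i; lia.
pose h := Ordinal lt_h; pose g := Ordinal lt_g.
have h_gt0 : (0 < \rank (flag_block M h))%N.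
  by rewrite rank_flag_block_gt0; apply/flag_spanP; exists a, b; split=> //=; lia.
have g_gt0 : (0 < \rank (flag_block M g))%N.
  by rewrite rank_flag_block_gt0; apply/flag_spanP; exists c, d; split=> //=; lia.
have hi : h != i by apply/eqP => /(congr1 val) /=; lia.
have gi : g != i by apply/eqP => /(congr1 val) /=; lia.
have gh : g != h by apply/eqP => /(congr1 val) /=; lia.
move: le3; rewrite leqNgt => /negP; apply.
rewrite /flag_rank (bigD1 i) // (bigD1 h) // (bigD1 g) ?gi //.
exact: leq_add gt1 (leq_add h_gt0 (leq_trans g_gt0 (leq_addr _ _))).
Qed.

End Spans.

(** * Counting functions by the size of their support *)

Lemma card_neq0 (F : finFieldType) : #|[set x : F | x != 0]| = (#|F| - 1)%N.
Proof.
rewrite subn1 -(cardC1 (0 : F)); apply: eq_card => x.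
by rewrite !inE.
Qed.

Lemma cardsUD (T : finType) (A B : {set T}) : #|A :|: B| = (#|A| + #|B :\: A|)%N.
Proof.
by rewrite cardsU cardsD setIC addnBA // subset_leq_card // subsetIl.
Qed.

Definition supp (F : finFieldType) (T : finType) (d : {ffun T -> F}) : {set T} :=
  [set x | d x != 0].

(** Once the part [B] of the support outside [A] is fixed, the values are independent: arbitrary on
    [A], nonzero on [B], zero elsewhere. Here [A] stands for the diagonal positions left free by a
    superdiagonal entry. *)
Lemma card_ffun_suppD (F : finFieldType) (T : finType) (A : {set T}) (k : nat) :
  #|[set d : {ffun T -> F} | #|supp d :\: A| == k]| =
  (#|F| ^ #|A| * ('C(#|T| - #|A|, k) * (#|F| - 1) ^ k))%N.
Proof.
have cardB (B : {set T}) : B \subset ~: A ->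
    #|[set d : {ffun T -> F} | supp d :\: A == B]| =
      (#|F| ^ #|A| * (#|F| - 1) ^ #|B|)%N.
  move=> /subsetP sB.
  (* [R x] is the set of values allowed at [x], so the class of [B] is a product of such sets. *)
  pose R x : {set F} :=
    if x \in A then setT else if x \in B then [set y | y != 0] else [set 0].
  rewrite (_ : #|_| = #|family R|); last first.
    apply: eq_card => d; rewrite inE; apply/eqP/familyP => [dB x | dR].
      rewrite /R -dB !inE; have [xA|xA] := boolP (x \in A); first by rewrite inE.
      by case: ifP => /= d0; rewrite !inE //; move/negbFE: d0.
    apply/setP => x; have := dR x; rewrite /R !inE.
    have [xA _|xA] := boolP (x \in A) => /=.
      by apply/esym/negP => /sB; rewrite inE xA.
    by case: ifP; rewrite !inE // => _ /eqP->; rewrite eqxx.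
  rewrite card_family foldrE big_map big_enum /=.
  rewrite (bigID (mem A)) /=; congr muln.
    rewrite -prod_nat_const; apply: eq_bigr => x xA.
    by rewrite /R xA cardsT.
  rewrite (bigID (mem B)) /= [X in (_ * X)%N]big1 ?muln1 => [|x /andP[xA xB]].
    rewrite -prod_nat_const; apply: eq_big => [x|x /andP[/negPf xA xB]].
      by case: (boolP (x \in B)) => [/sB|]; rewrite ?andbF // inE => ->.
    by rewrite /R xA xB card_neq0.
  by rewrite /R (negPf xA) (negPf xB) cards1.
rewrite -sum1_card (partition_big (fun d => supp d :\: A)
   (fun B : {set T} => (B \subset ~: A) && (#|B| == k))) /=; last first.
  by move=> d; rewrite inE => ->; rewrite andbT setDE subsetIr.
rewrite (eq_bigr (fun=> (#|F| ^ #|A| * (#|F| - 1) ^ k)%N)).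
  rewrite sum_nat_const mulnCA; congr (_ * (_ * _))%N.
  have <- : #|~: A| = (#|T| - #|A|)%N by rewrite -(cardsC A) addKn.
  by rewrite -cards_draws; apply: eq_card => B; rewrite inE.
move=> B /andP[sBA /eqP <-]; rewrite -cardB // -[RHS]sum1_card.
apply: eq_bigl => d; rewrite !inE andbC.
by case: eqP => //= ->; rewrite eqxx.
Qed.

Lemma card_ord_interval n a k :
  (a + k <= n)%N -> #|[set i : 'I_n | a <= i < a + k]%N| = k.
Proof.
elim: k => [|k IHk] ak.
  by apply/eqP; rewrite cards_eq0; apply/eqP/setP => i; rewrite !inE; lia.
have lt_ak : (a + k < n)%N by lia.
rewrite (_ : [set i : 'I_n | _] =
             Ordinal lt_ak |: [set i : 'I_n | a <= i < a + k]%N).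
  by rewrite cardsU1 IHk ?inE /=; lia.
by apply/setP => i; rewrite !inE -val_eqE /=; lia.
Qed.

(** * The parametrised families and the indices they cover *)

Section Families.

Variables (F : finFieldType) (n : nat).
Implicit Types (M : 'M[F]_n) (d : {ffun 'I_n -> F}).

(** Serves two kinds at once: for [x = 0] it is the diagonal matrix of [d], written [band 0 0 d]
    below. *)
Definition band (a : nat) (x : F) d : 'M[F]_n :=
  \matrix_(i, j) if (i == a :> nat) && (j == a.+1 :> nat) then x
                 else if i == j then d i else 0.

(* The upper triangular part of a rank-one matrix supported on
   [a, a.+2] x [a, a.+2], normalised by its corner entry c at (a, a.+2). *)
Definition corner (a : nat) (c s t u v : F) : 'M[F]_n :=
  \matrix_(i, j) if [&& a <= i, i <= j & j <= a.+2]%N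
                 then c * nth 0 [:: 1; t; u] (i - a) * nth 0 [:: v; s; 1] (j - a)
                 else 0.

Lemma band_upper a x d : band a x d \in upper_mx F n.
Proof.
rewrite inE; apply/forallP => i; apply/forallP => j; apply/implyP => ji.
rewrite mxE; case: ifP => [|_]; first by lia.
by case: ifP => // /eqP ij; move: ji; rewrite ij ltnn.
Qed.

Lemma corner_upper a c s t u v : corner a c s t u v \in upper_mx F n.
Proof.
rewrite inE; apply/forallP => i; apply/forallP => j; apply/implyP => ji.
by rewrite mxE; case: ifP => //; lia.
Qed.

(** Inside block [i] rows are at most [i] and columns at least [i], so the triangular truncation is
    invisible there; what is left is an outer product restricted to a rectangle. *)
Lemma corner_small_blocks a c s t u v : small_blocks (corner a c s t u v).
Proof.
move=> i i1 i2 j1 j2 /andP[? ?] /andP[? ?]; rewrite !mxE.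
rewrite (leq_trans _ (_ : i <= j1)%N) // (leq_trans _ (_ : i <= j2)%N) //.
rewrite (leq_trans _ (_ : i <= j1)%N) // (leq_trans _ (_ : i <= j2)%N) //=.
by do 4![case: ifP => ?] => /=; try lia; ring.
Qed.

(** The nonzero entries of a block lie in a single row (if [i = a]), a single column (if [i = a.+1])
    or at [(i, i)] alone. Two distinct rows and columns therefore make both products vanish. *)
Lemma band_small_blocks a x d : small_blocks (band a x d).
Proof.
move=> i i1 i2 j1 j2 /andP[? ?] /andP[? ?]; rewrite !mxE -!val_eqE /=.
have [->|n12] := eqVneq i1 i2; first by rewrite mulrC.
have [->//|m12] := eqVneq j1 j2.
rewrite -val_eqE /= in n12; rewrite -val_eqE /= in m12.
by do 4![case: ifP => ?; last case: ifP => ?]; rewrite ?mulr0 ?mul0r //; lia.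
Qed.

Lemma flag_span_diag d : flag_span (band 0 0 d) = supp d.
Proof.
apply/setP => i; apply/flag_spanP/idP => [[a [b [ai ib]]]|]; rewrite inE => di.
  rewrite mxE in di; case: ifP di => _; first by rewrite eqxx.
  case: ifP => [/eqP ab|_]; last by rewrite eqxx.
  by rewrite (_ : i = a) //; apply: val_inj; apply/eqP; rewrite eqn_leq ai {1}ab ib.
exists i, i; split=> //; rewrite mxE eqxx.
by case: ifP => //; lia.
Qed.

Lemma flag_span_band a x d : (a.+1 < n)%N -> x != 0 ->
  flag_span (band a x d) = [set i : 'I_n | a <= i < a + 2]%N :|: supp d.
Proof.
move=> an x0; have an' : (a < n)%N by lia.
apply/setP => i; apply/flag_spanP/idP => [[k [l [ki il]]]|].
  rewrite mxE !inE; case: ifP => [kl _|_]; first by apply/orP; left; lia.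
  case: ifP => [/eqP kl dk|]; last by rewrite eqxx.
  suff -> : i = k by rewrite dk orbT.
  by apply: val_inj; apply/eqP; rewrite eqn_leq ki {1}kl il.
rewrite !inE => /orP[ai|di].
  by exists (Ordinal an'), (Ordinal an); split=> /=; rewrite ?mxE /= ?eqxx //; lia.
exists i, i; split=> //; rewrite mxE eqxx.
by case: ifP => //; lia.
Qed.

Lemma flag_span_corner a c s t u v : (a.+2 < n)%N -> c != 0 ->
  flag_span (corner a c s t u v) = [set i : 'I_n | a <= i < a + 3]%N.
Proof.
move=> an c0; have an' : (a < n)%N by lia.
apply/setP => i; rewrite [RHS]inE; apply/flag_spanP/idP => [[k [l [ki il]]]|ai].
  by rewrite mxE; case: ifP => [|_]; [lia | rewrite eqxx].
exists (Ordinal an'), (Ordinal an); split=> /=; [lia | lia |].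
rewrite mxE /= leqnn leqnn /= leqW // subnn -addn2 addKn /=.
by rewrite !mulr1.
Qed.

End Families.

(** * Spheres of radius at most 3, split by the highest nonzero superdiagonal *)

Section Spheres.

Variables (F : finFieldType) (n : nat).
Implicit Types (M : 'M[F]_n) (d : {ffun 'I_n -> F}).

(** Source of the contradictions below: four distinct covered indices exclude weight at most 3.
    Plain naturals suffice in [s], since being covered bounds them by [n]. *)
Lemma leq_card_flag_span M (s : seq nat) : uniq s ->
    (forall k, k \in s ->
       exists a b : 'I_n, [/\ (a <= k)%N, (k <= b)%N & M a b != 0]) ->
  (size s <= #|flag_span M|)%N.
Proof.
move=> s_uniq sM; rewrite cardE -(size_map val); apply: uniq_leq_size => // k.
move=> /sM[a [b [ak kb Mab]]].
have lt_k : (k < n)%N by have := ltn_ord b; lia.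
apply/mapP; exists (Ordinal lt_k) => //; rewrite mem_enum.
by apply/flag_spanP; exists a, b.
Qed.

Lemma upper_mx0 M (i j : 'I_n) : M \in upper_mx F n -> (j < i)%N -> M i j = 0.
Proof.
by rewrite inE => /forallP/(_ i)/forallP/(_ j)/implyP M0 ji; apply/eqP/M0.
Qed.

Definition sphere (w : nat) : {set 'M[F]_n} :=
  [set M in upper_mx F n | flag_rank M == w].

Definition has_shift (k : nat) : {set 'M[F]_n} :=
  [set M : 'M[F]_n |
    [exists i : 'I_n, exists j : 'I_n, (j == i + k :> nat)%N && (M i j != 0)]].

Lemma has_shiftP k M :
  reflect (exists i j : 'I_n, (j = i + k :> nat)%N /\ M i j != 0)
          (M \in has_shift k).
Proof.
rewrite inE; apply: (iffP existsP) => [[i /existsP[j /andP[/eqP ? ?]]]|].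
  by exists i, j.
by move=> [i [j [ij ?]]]; exists i; apply/existsP; exists j; rewrite ij eqxx.
Qed.

Lemma sphere_small_blocks w M : (w <= 3)%N -> M \in sphere w -> small_blocks M.
Proof.
move=> w3; rewrite inE => /andP[_ /eqP Mw].
by apply: flag_rank_le3_small_blocks; rewrite Mw.
Qed.

Lemma sphere_card_flag_span w M :
  (w <= 3)%N -> M \in sphere w -> #|flag_span M| = w.
Proof.
move=> w3 Mw; rewrite -flag_rank_small_blocks; last exact: sphere_small_blocks Mw.
by move: Mw; rewrite inE => /andP[_ /eqP].
Qed.

Lemma mem_sphere w M : M \in upper_mx F n -> small_blocks M ->
  (M \in sphere w) = (#|flag_span M| == w).
Proof. by move=> Mu Ms; rewrite inE Mu /= flag_rank_small_blocks. Qed.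

(** Such an entry would cover the four indices from [i] to [i + 3]. *)
Lemma flag_rank_le3_diam w M (i j : 'I_n) :
  (w <= 3)%N -> M \in sphere w -> (j > i + 2)%N -> M i j = 0.
Proof.
move=> w3 Mw ij; apply/eqP; apply: contraLR (w3) => Mij; rewrite -ltnNge.
rewrite -(sphere_card_flag_span w3 Mw).
apply: (@leq_card_flag_span M [:: i : nat; i + 1; i + 2; i + 3]%N).
  by rewrite /= !inE; lia.
move=> k; rewrite !inE => ki; exists i, j; split=> //; lia.
Qed.

Lemma bandE (a : nat) (x : F) d (i j : 'I_n) : i = a :> nat -> j = a.+1 :> nat ->
  band a x d i j = x.
Proof. by move=> ia ja; rewrite mxE ia ja !eqxx. Qed.

Lemma band_diagE (a : nat) (x : F) d (i : 'I_n) : band a x d i i = d i.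
Proof. by rewrite mxE eqxx; case: ifP => //; lia. Qed.

Lemma cornerE (a : nat) (c s t u v : F) (i j : 'I_n) k l :
    i = (a + k)%N :> nat -> j = (a + l)%N :> nat -> (k <= l <= 2)%N ->
  corner n a c s t u v i j = c * nth 0 [:: 1; t; u] k * nth 0 [:: v; s; 1] l.
Proof.
by move=> ia ja kl; rewrite mxE ia ja !addKn; case: ifP => //; lia.
Qed.

Definition corner_par (p : 'I_(n - 2) * (F * (F * F * F * F))) : 'M[F]_n :=
  let: (a, (c, (s, t, u, v))) := p in corner n a c s t u v.

Definition corner_dom : {set 'I_(n - 2) * (F * (F * F * F * F))} :=
  setX setT (setX [set c | c != 0] setT).

Lemma ltn_ord_sub k (a : 'I_(n - k)) l : (l <= k)%N -> (a + l < n)%N.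
Proof. by move: (ltn_ord a); lia. Qed.

(** The corner entry is [c], and being nonzero it locates [a]. The entries [c * s], [c * t], [c * u]
    and [c * v] then yield the other parameters after cancelling [c]. *)
Lemma corner_par_inj : {in corner_dom &, injective corner_par}.
Proof.
move=> [a [c [[[s t] u] v]]] [a' [c' [[[s' t'] u'] v']]].
rewrite !inE /= !andbT => c0 c'0 eqM.
pose o k (hk : (k <= 2)%N) := Ordinal (ltn_ord_sub a hk).
have eqE (i j : 'I_n) := congr1 (fun M : 'M[F]_n => M i j) eqM.
have /= eqC := eqE (o 0 isT) (o 2 isT).
(* A nonzero entry at [(a, a + 2)] must lie in the box of [a'], so [a' <= a] and
   [a + 2 <= a' + 2]. *)
have aa : a = a'.
  move: eqC; rewrite (@cornerE _ _ _ _ _ _ _ _ 0 2) //= !mulr1 mxE /=.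
  by case: ifP => [? _|_ /eqP]; [apply: val_inj => /=; lia | rewrite (negPf c0)].
move: eqE eqC; rewrite -{}aa => eqE.
rewrite !(@cornerE _ _ _ _ _ _ _ _ 0 2) //= !mulr1 => cc; rewrite -{}cc in eqE *.
have := eqE (o 0 isT) (o 1 isT).
rewrite !(@cornerE _ _ _ _ _ _ _ _ 0 1) //= => /(mulfI _) ->; last by rewrite mulr1.
have := eqE (o 1 isT) (o 2 isT).
rewrite !(@cornerE _ _ _ _ _ _ _ _ 1 2) //= !mulr1 => /(mulfI c0) ->.
have := eqE (o 2 isT) (o 2 isT).
rewrite !(@cornerE _ _ _ _ _ _ _ _ 2 2) //= !mulr1 => /(mulfI c0) ->.
have := eqE (o 0 isT) (o 0 isT).
rewrite !(@cornerE _ _ _ _ _ _ _ _ 0 0) //= => /(mulfI _) -> //.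
by rewrite mulr1.
Qed.

(** A nonzero entry at [(i, i + 2)] already covers three indices. This forces [w = 3], hence the
    filter emptying the image for smaller [w], and confines the support to the box of that entry. *)
Lemma sphere_has_shift2 w : (w <= 3)%N ->
  sphere w :&: has_shift 2 = [set corner_par p | p in corner_dom & w == 3].
Proof.
move=> w3; apply/setP => M; apply/setIP/imsetP; last first.
  move=> [[a [c [[[s t] u] v]]] dom ->].
  have {dom} [c0 /eqP w_eq] : c != 0 /\ w == 3.
    by move: dom; rewrite !inE /= andbT => /andP[].
  have a2 := ltn_ord_sub a (leqnn 2).
  rewrite /corner_par; split.
    rewrite mem_sphere; [|exact: corner_upper|exact: corner_small_blocks].
    rewrite flag_span_corner -?addn2 // card_ord_interval ?w_eq //.
    by move: a2; lia.
  apply/has_shiftP; exists (Ordinal (ltn_ord_sub a (leq0n 2))), (Ordinal a2).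
  by split; [rewrite /= addn0 | rewrite (@cornerE _ _ _ _ _ _ _ _ 0 2) //= !mulr1].
move=> [Mw /has_shiftP[i [k [ik Mik]]]].
have Msb := sphere_small_blocks w3 Mw.
have Mc := sphere_card_flag_span w3 Mw.
have Mu : M \in upper_mx F n by move: Mw; rewrite inE => /andP[].
have lt_j : (i + 1 < n)%N by have := ltn_ord k; lia.
pose j := Ordinal lt_j.
have lt_a : (i < n - 2)%N by have := ltn_ord k; lia.
(* Parameters are read off by dividing by the corner entry. The middle entry [M j j] is absent
   because a minor determines it. *)
pose p := (Ordinal lt_a, (M i k, (M i j / M i k, M j k / M i k,
                                  M k k / M i k, M i i / M i k))).
have M0 (r s : 'I_n) : (r < i)%N || (k < s)%N -> M r s = 0.
  move=> rs; apply/eqP; apply: contraLR (w3) => Mrs; rewrite -ltnNge -Mc.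
  have rs' : (r <= s)%N.
    by rewrite leqNgt; apply: contraNN Mrs => /(upper_mx0 Mu) ->.
  (* A fourth covered index: the row of the stray entry if it lies above the box, otherwise its
     column, to the right of the box. *)
  pose e : nat := if (r < i)%N then r else s.
  apply: (@leq_card_flag_span M [:: e; i : nat; i + 1; i + 2]%N).
    by rewrite /= !inE /e; case: ifP rs => /=; lia.
  move=> h; rewrite in_cons => /orP[/eqP->|].
    by exists r, s; split=> //; rewrite /e; case: ifP rs => /=; lia.
  by rewrite !inE => hi; exists i, k; split=> //; lia.
have defM : M = corner_par p.
  apply/matrixP => r s; rewrite /corner_par /=.
  have [ir|ri] := leqP i r; last first.
    by rewrite M0 ?ri // mxE; case: ifP => //; lia.
  have [sk|ks] := leqP s k; last first.
    by rewrite M0 ?ks ?orbT // mxE; case: ifP => //; lia.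
  have [rs|sr] := leqP r s; last first.
    by rewrite (upper_mx0 Mu) // mxE; case: ifP => //; lia.
  have /or3P[/eqP ri|/eqP rj|/eqP rk] :
      [|| r == i :> nat, r == i + 1 :> nat | r == i + 2 :> nat]%N by lia.
  - have /or3P[/eqP si|/eqP sj|/eqP sk'] :
        [|| s == i :> nat, s == i + 1 :> nat | s == i + 2 :> nat]%N by lia.
    + rewrite (@cornerE _ _ _ _ _ _ _ _ 0 0) /= ?ri ?si ?addn0 //.
      by rewrite (val_inj ri) (val_inj si); field.
    + rewrite (@cornerE _ _ _ _ _ _ _ _ 0 1) /= ?ri ?sj ?addn0 //.
      by rewrite (val_inj ri) (val_inj (sj : val s = val j)); field.
    rewrite (@cornerE _ _ _ _ _ _ _ _ 0 2) /= ?ri ?sk' ?addn0 //.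
    by rewrite (val_inj ri) (val_inj (etrans sk' (esym ik))); field.
  - have /orP[/eqP sj|/eqP sk'] : (s == i + 1 :> nat)%N || (s == i + 2 :> nat)%N.
      by lia.
    + rewrite (@cornerE _ _ _ _ _ _ _ _ 1 1) /= ?rj ?sj //.
      rewrite (val_inj (rj : val r = val j)) (val_inj (sj : val s = val j)).
      (* The rank condition enters here: block [j] gives [M i k * M j j = M i j * M j k]. *)
      apply: (mulfI Mik); rewrite (Msb j); [by field | |] => /=; lia.
    rewrite (@cornerE _ _ _ _ _ _ _ _ 1 2) /= ?rj ?sk' //.
    rewrite (val_inj (rj : val r = val j)) (val_inj (etrans sk' (esym ik))).
    by field.
  have sk' : s = (i + 2)%N :> nat by lia.
  rewrite (@cornerE _ _ _ _ _ _ _ _ 2 2) /= ?rk ?sk' //.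
  rewrite (val_inj (etrans rk (esym ik))) (val_inj (etrans sk' (esym ik))).
  by field.
exists p => //; rewrite !inE /= Mik /=.
by rewrite -Mc defM flag_span_corner //= ?card_ord_interval //; lia.
Qed.

Lemma card_corner_dom : #|corner_dom| = ((n - 2) * #|F| ^ 4 * (#|F| - 1))%N.
Proof.
rewrite !cardsX card_neq0 !cardsT !card_prod card_ord; ring.
Qed.

Definition band_par (p : 'I_(n - 1) * F * {ffun 'I_n -> F}) : 'M[F]_n :=
  band p.1.1 p.1.2 p.2.

Definition band_dom (w : nat) : {set 'I_(n - 1) * F * {ffun 'I_n -> F}} :=
  [set p : 'I_(n - 1) * F * {ffun 'I_n -> F} | (p.1.2 != 0) &&
           (#|[set i : 'I_n | p.1.1 <= i < p.1.1 + 2]%N :|: supp p.2| == w)].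

(** The diagonal gives back [d], and the only nonzero entry off the diagonal gives back [a] and
    [x]. *)
Lemma band_par_inj w : {in band_dom w &, injective band_par}.
Proof.
move=> [[a x] d] [[a' x'] d']; rewrite !inE /= => /andP[x0 _] /andP[x'0 _].
rewrite /band_par /= => eqM.
have eqE (i j : 'I_n) := congr1 (fun M : 'M[F]_n => M i j) eqM.
have dd : d = d'.
  by apply/ffunP => i; have := eqE i i; rewrite !band_diagE.
pose i := Ordinal (ltn_ord_sub a (leq0n 1)); pose j := Ordinal (ltn_ord_sub a (leqnn 1)).
have xE : x = band a' x' d' i j by rewrite -eqM bandE //=; lia.
have aa : a = a'.
  apply: val_inj; move: x0; rewrite xE mxE; case: ifP => [/andP[/eqP] //= | _].
    by rewrite addn0.
  by case: ifP => [/eqP/(congr1 val) /=|_]; [lia | rewrite eqxx].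
by rewrite xE -{}aa bandE ?dd //=; lia.
Qed.

(** The point is that only one superdiagonal entry is nonzero: two consecutive ones contradict a
    minor, and two that share no index cover four indices. *)
Lemma sphere_has_shift1 w : (w <= 3)%N ->
  (sphere w :\: has_shift 2) :&: has_shift 1 = band_par @: band_dom w.
Proof.
move=> w3; apply/setP => M; apply/setIP/imsetP; last first.
  move=> [[[a x] d] dom ->].
  have {dom} [x0 cw] : x != 0 /\ #|[set i : 'I_n | a <= i < a + 2]%N :|: supp d| = w.
    by move: dom; rewrite inE /= => /andP[? /eqP].
  have a1 := ltn_ord_sub a (leqnn 1).
  rewrite /band_par /=; split.
    apply/setDP; split.
      rewrite mem_sphere; [|exact: band_upper|exact: band_small_blocks].
      by rewrite flag_span_band ?cw //; move: a1; rewrite addn1.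
    apply/has_shiftP => -[i [j [ij]]]; rewrite mxE.
    case: ifP => [|_]; first by lia.
    by case: ifP => [/eqP/(congr1 val) /=|_]; [lia | rewrite eqxx].
  apply/has_shiftP; exists (Ordinal (ltn_ord_sub a (leq0n 1))), (Ordinal a1).
  by split; [rewrite /= addn0 | rewrite bandE //=; lia].
move=> [/setDP[Mw nM2] /has_shiftP[i [j [ij Mij]]]].
have Msb := sphere_small_blocks w3 Mw.
have Mc := sphere_card_flag_span w3 Mw.
have Mu : M \in upper_mx F n by move: Mw; rewrite inE => /andP[].
have M2 (r s : 'I_n) : s = (r + 2)%N :> nat -> M r s = 0.
  move=> rs; apply/eqP; apply: contraNT nM2 => Mrs.
  by apply/has_shiftP; exists r, s.
have lt_a : (i < n - 1)%N by have := ltn_ord j; lia.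
pose p := (Ordinal lt_a, M i j, [ffun k => M k k]).
have defM : M = band_par p.
  apply/matrixP => r s; rewrite /band_par /= mxE /=.
  case: ifP => [/andP[/eqP ri /eqP sj]|nrs].
    by congr (M _ _); apply: val_inj; rewrite /= ?ri // sj ij addn1.
  case: ifP => [/eqP<-|nrs']; first by rewrite ffunE.
  have {nrs'} rs_neq : r != s :> nat.
    by apply/negP => /eqP/val_inj/eqP; rewrite nrs'.
  have [rs|sr] := leqP r s; last by rewrite (upper_mx0 Mu).
  have [|rs2] := leqP s (r + 2); last exact: flag_rank_le3_diam Mw _.
  rewrite leq_eqVlt => /orP[/eqP /M2 //|lt_s].
  have sE : s = (r + 1)%N :> nat by lia.
  (* Consecutive positions: the minor of the block at the shared index has a factor on the second
     superdiagonal, where [M] vanishes, so [M r s = 0]. *)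
  have [ri|ri] := eqVneq (r : nat) (i + 1)%N.
    have rj : r = j by apply: val_inj; rewrite /= ri ij.
    have : M i j * M j s = M i s * M j j by apply: (Msb j); lia.
    rewrite rj (M2 i s) ?mul0r; last by lia.
    by move/eqP; rewrite mulf_eq0 (negPf Mij) => /eqP.
  have [ir|ir] := eqVneq (i : nat) (r + 1)%N.
    have si : s = i by apply: val_inj; rewrite /= sE ir.
    have : M r i * M i j = M r j * M i i by apply: (Msb i); lia.
    rewrite si (M2 r j) ?mul0r; last by lia.
    by move/eqP; rewrite mulf_eq0 (negPf Mij) orbF => /eqP.
  (* Now [i], [j], [r], [s] are pairwise distinct, and all would be covered. *)
  apply/eqP; apply: contraLR (w3) => Mrs; rewrite -ltnNge -Mc.
  apply: (@leq_card_flag_span M [:: i : nat; j : nat; r : nat; s : nat]%N).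
    by rewrite /= !inE; move: nrs ri ir; lia.
  move=> k; rewrite !inE => hk.
  have [ki|ki] := boolP ((k == i :> nat) || (k == j :> nat)).
    by exists i, j; split=> //; lia.
  by exists r, s; split=> //; lia.
exists p => //; rewrite inE /= Mij /=.
by rewrite -Mc {2}defM flag_span_band //=; lia.
Qed.

(** The interval uses 2 units of weight and leaves its two diagonal entries free, whence [#|F| ^ 2].
    The other [w] units are nonzero diagonal entries outside it; [x] supplies one more factor
    [#|F| - 1]. *)
Lemma card_band_dom w : #|band_dom w.+2| =
  ((n - 1) * #|F| ^ 2 * ('C(n - 2, w) * (#|F| - 1) ^ w.+1))%N.
Proof.
pose A (a : 'I_(n - 1)) : {set 'I_n} := [set i : 'I_n | a <= i < a + 2]%N.
pose D a := [set d : {ffun 'I_n -> F} | #|supp d :\: A a| == w].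
have cA a : #|A a| = 2 by rewrite card_ord_interval //; have := ltn_ord a; lia.
transitivity (\sum_(ax : 'I_(n - 1) * F | ax.2 != 0%R) #|D ax.1|)%N.
  under [RHS]eq_bigr => ax _ do rewrite -sum1_card.
  rewrite -sum1_card pair_big_dep /=; apply: eq_bigl => p.
  by rewrite !inE cardsUD cA eqn_add2l.
under eq_bigr => ax _ do rewrite card_ffun_suppD cA card_ord.
rewrite sum_nat_const -cardsE (_ : [set _ | _] = setX setT [set x | x != 0]).
  by rewrite cardsX cardsT card_ord card_neq0 (expnS _ w); ring.
by apply/setP => ax; rewrite !inE.
Qed.

(** Entries at distance 1 and 2 from the diagonal are excluded, larger distances are ruled out by
    the weight, so [M] is diagonal and its weight is the size of its support. *)
Lemma card_sphere_diag w : (w <= 3)%N ->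
  #|(sphere w :\: has_shift 2) :\: has_shift 1| = ('C(n, w) * (#|F| - 1) ^ w)%N.
Proof.
move=> w3.
(* Removing [set0] brings the set into the shape of [card_ffun_suppD], with no free position. *)
rewrite (_ : _ :\: _ =
    band 0 0 @: [set d : {ffun 'I_n -> F} | #|supp d :\: set0| == w]).
  rewrite card_imset; last first.
    by move=> d d' eqM; apply/ffunP => i; rewrite -(band_diagE 0 0 d) eqM band_diagE.
  by rewrite card_ffun_suppD cards0 card_ord subn0 mul1n.
apply/setP => M; apply/setDP/imsetP => [[/setDP[Mw nM2] nM1]|[d dom ->]];
  last first.
  have {dom} cw : #|supp d| = w by move: dom; rewrite inE setD0 => /eqP.
  have diag0 (i j : 'I_n) : (i < j)%N -> band 0 0 d i j = 0.
    move=> ij; rewrite mxE; case: ifP => // _; case: ifP => // /eqP/(congr1 val) /=.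
    by lia.
  split.
    apply/setDP; split.
      rewrite mem_sphere; [|exact: band_upper|exact: band_small_blocks].
      by rewrite flag_span_diag cw.
    by apply/has_shiftP => -[i [j [ij]]]; rewrite diag0 ?eqxx //; lia.
  by apply/has_shiftP => -[i [j [ij]]]; rewrite diag0 ?eqxx //; lia.
have Mu : M \in upper_mx F n by move: Mw; rewrite inE => /andP[].
have defM : M = band 0 0 [ffun i => M i i].
  apply/matrixP => i j; rewrite mxE.
  have [<-|nij] := eqVneq i j; first by rewrite ffunE; case: ifP => //; lia.
  rewrite if_same; have [ij|ji] := leqP i j; last by rewrite (upper_mx0 Mu).
  have {nij} nij : i != j :> nat by [].
  have [|ij2] := leqP j (i + 2); last exact: flag_rank_le3_diam Mw _.
  rewrite leq_eqVlt => /orP[/eqP jE|lt_j].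
    by apply/eqP; apply: contraNT nM2 => Mij; apply/has_shiftP; exists i, j.
  apply/eqP; apply: contraNT nM1 => Mij; apply/has_shiftP; exists i, j.
  by split=> //; lia.
exists [ffun i => M i i] => //.
by rewrite inE setD0 -flag_span_diag -defM (sphere_card_flag_span w3 Mw).
Qed.

End Spheres.

(** * Summing the three kinds over each sphere and the spheres over each ball *)

Section Counting.

Variables (F : finFieldType) (n : nat).

Lemma card_band_dom0 w : (w < 2)%N -> #|band_dom F n w| = 0%N.
Proof.
move=> w2; apply: eq_card0 => p; rewrite inE cardsUD card_ord_interval.
  by apply/negP => /andP[_ /eqP]; lia.
by have := ltn_ord_sub p.1.1 (leqnn 1); rewrite addn1 addn2.
Qed.

Lemma card_sphere w : (w <= 3)%N ->
  #|sphere F n w| =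
  ((w == 3) * #|corner_dom F n| + #|band_dom F n w|
   + 'C(n, w) * (#|F| - 1) ^ w)%N.
Proof.
move=> w3; rewrite -(cardsID (has_shift F n 2)) -addnA; congr addn.
  rewrite sphere_has_shift2 // card_in_imset.
    case: eqP => [_|_]; rewrite ?mul1n ?mul0n; [apply: eq_card|apply: eq_card0].
      by move=> p; rewrite inE andbT.
    by move=> p; rewrite inE andbF.
  by move=> p p' /setIdP[pX _] /setIdP[p'X _]; apply: corner_par_inj.
rewrite -(cardsID (has_shift F n 1)) card_sphere_diag // sphere_has_shift1 //.
by rewrite card_in_imset //; apply: band_par_inj.
Qed.

Lemma ball_size0 : ball_size F n 0 = #|sphere F n 0|.
Proof. by apply: eq_card => M; rewrite !inE leqn0. Qed.

Lemma ball_sizeS t : ball_size F n t.+1 = (ball_size F n t + #|sphere F n t.+1|)%N.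
Proof.
rewrite -[LHS](cardsID [set M | flag_rank M <= t]%N).
by congr addn; apply: eq_card => M; rewrite !inE; lia.
Qed.

End Counting.

Local Close Scope ring_scope.
Unset Implicit Arguments.

Theorem corollary3p4 (F : finFieldType) (q n : nat)
    (hq : #|F| = q) (hn : 3 <= n) :
  [/\ ball_size F n 0 = 1,
      ball_size F n 1 = 1 + n * (q - 1),
      ball_size F n 2 =
        1 + n * (q - 1) + (n - 1) * q ^ 2 * (q - 1) + 'C(n, 2) * (q - 1) ^ 2
    & ball_size F n 3 =
        1 + n * (q - 1) + (n - 1) * q ^ 2 * (q - 1) + 'C(n, 2) * (q - 1) ^ 2
        + (n - 2) * q ^ 4 * (q - 1)
        + (n - 1) * (n - 2) * q ^ 2 * (q - 1) ^ 2
        + 'C(n, 3) * (q - 1) ^ 3].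
Proof.
rewrite !ball_sizeS ball_size0 !card_sphere // !card_band_dom !card_band_dom0 //.
rewrite card_corner_dom hq !bin0 !bin1 !expn0 !expn1.
(* The factor [n - 2] of the mixed term is ['C(n - 2, 1)]. The truncated differences occur
   identically on both sides, so [ring] may treat them as atoms. *)
by split; rewrite /=; ring.
Qed.
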